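(* Let $t_n$ be the smallest integer $t$ with $\frac1t+\frac1{t+1}+\dots+\frac1{n-1}\le 1$, and for $k\in\{1,\dots,n\}$ let \[r_{k,n}=\frac{t_n-1}{n}\left(\sum_{i=t_n}^{n-k+1}\frac{\binom{n-k}{i-1}}{\binom{n-1}{i-1}}\frac{1}{i-1}+\frac{1}{n-1}\right),\qquad a_m=\sum_{s=m}^{\infty}\frac1s\left(1-\frac1e\right)^s.\] Let $l\ge1$ be a constant and let $k\in\{2,\dots,n-l\}$ (where $k$ may be a fixed integer or a function of $n$). Then \[\lim_{n\to\infty}\frac{r_{k,n}}{r_{k+l,n}}\ <\ \frac{1}{a_{l+1}}.\]
   Context: An empty sum is $0$, and $\binom{a}{b}=0$ when $b>a$. (The quantity $r_{k,n}$ is the probability that the optimal secretary algorithm selects the $k$-th best of $n$ candidates arriving in uniformly random order.)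
   Formalization: When k is a function of n the limit need not exist (e.g. k alternating between 2 and 3), so there ''lim'' is read as ''limsup'', which equals the limit whenever it exists; for fixed k the limit is shown to exist and to satisfy the bound. *)

(* Defs.v *)
From mathcomp Require Import all_boot all_order all_algebra.
From mathcomp Require Import all_classical all_reals all_analysis.
Import Order.TTheory GRing.Theory Num.Theory.
Import numFieldNormedType.Exports.

Set Implicit Arguments.
Unset Strict Implicit.
Unset Printing Implicit Defensive.

Local Open Scope classical_set_scope.
Local Open Scope ring_scope.

(* Positivity of t is explicit because 0^-1 = 0 would otherwise admit t = 0
   when n <= 2. *)
Definition threshold_pred (R : realType) (n : nat) : pred nat :=
  fun t => (0 < t)%N && (\sum_(t <= s < n) (s%:R : R)^-1 <= 1).

Lemma threshold_ex (R : realType) (n : nat) : exists t, threshold_pred R n t.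
Proof. by exists n.+1; rewrite /threshold_pred big_geq // ler01. Qed.

Definition threshold (R : realType) (n : nat) : nat :=
  ex_minn (threshold_ex R n).

Definition select_prob (R : realType) (k n : nat) : R :=
  ((threshold R n)%:R - 1) / n%:R *
  (\sum_(threshold R n <= i < (n - k + 1).+1)
      'C(n - k, i - 1)%:R / 'C(n - 1, i - 1)%:R * (i%:R - 1)^-1
   + (n%:R - 1)^-1).

Definition log_tail (R : realType) (m : nat) : R :=
  \big[+%R/0]_(m <= s <oo) (s%:R^-1 * (1 - (expR 1)^-1) ^+ s).

(* Main.v *)
Require Import Defs.
From mathcomp Require Import all_boot all_order all_algebra.
From mathcomp Require Import all_classical all_reals all_analysis.
From mathcomp Require Import ring lra.
From mathcomp Require Import zify.
Import Order.TTheory GRing.Theory Num.Theory.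
Import numFieldNormedType.Exports.

Local Open Scope classical_set_scope.
Local Open Scope ring_scope.

(* Put m = n - 1, t = t_n - 1, N = n - t, q = 1 - 1/e.  By Pascal's rule and
   the hockey-stick identity the sum in r_{k,n} equals
   A_k = \sum_(k <= s <= m) 'C(N, s) / 'C(m, s) / s.  Comparing harmonic sums
   with logarithms, n/e <= t_n <= n/e + 2, so N/m -> q, and A_1 -> 1 by the
   choice of t_n; hence A_k -> 1 - \sum_(1 <= s < k) q^s/s for fixed k.
   Letting k grow, this limit is also a_k, with a_1 = 1.

   a_{k+l} is the sum over s >= k of q^s/s weighted by q^l s/(s + l), which
   increases with s; so a_{k+l}/a_k increases strictly with k, and
   a_k/a_{k+l} <= a_2/a_{l+2} < a_1/a_{l+1} for k >= 2.

   For a bound uniform in k take B strictly between a_2/a_{l+2} and 1/a_{l+1};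
   then q^l B > 1.  For large k the terms of A_k with s <= m/h are at most B
   times the terms of A_{k+l} shifted by l, and the terms with s > m/h are
   exponentially small in m, hence absorbed by (B - 1)/(n - 1).  The finitely
   many small k follow from the limits. *)

(** * Binomial identities and the tail form of the selection sum *)

Lemma sum_bin_nat (n b : nat) :
  (\sum_(0 <= i < n) 'C(i, b) = 'C(n, b.+1))%N.
Proof.
elim: n => [|n IH]; first by rewrite big_geq.
by rewrite big_nat_recr //= IH binS.
Qed.

Lemma sum_bin_sub (m t b : nat) :
  (\sum_(t <= j < m) 'C(m.-1 - j, b) = 'C(m - t, b.+1))%N.
Proof.
have [mt|tm] := leqP m t.
  by rewrite big_geq // (eqP mt) bin0n.
rewrite -sum_bin_nat -{1}[t]add0n big_addn big_nat_rev /=.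
apply: eq_big_nat => i /andP[_ im]; congr 'C(_, _); lia.
Qed.

(** Both sides are m! / (a! b! (m - a - b)!), the number of disjoint pairs of an [a]-set and a
    [b]-set; if a + b > m, both vanish. *)
Lemma mul_bin_trinom (m a b : nat) : (a <= m)%N -> (b <= m)%N ->
  ('C(m - b, a) * 'C(m, b) = 'C(m - a, b) * 'C(m, a))%N.
Proof.
move=> am bm; have [abm|mab] := leqP (a + b) m; last first.
  by rewrite (@bin_small (m - b)) 1?(@bin_small (m - a)) //; lia.
have F := fact_gt0; apply/eqP.
rewrite -(eqn_pmul2r (F a)) -(eqn_pmul2r (F b)) -(eqn_pmul2r (F (m - b - a)%N)).
have Eb := bin_fact bm; have Ea := bin_fact am.
have Eab : ('C(m - b, a) * (a`! * (m - b - a)`!) = (m - b)`!)%N.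
  by apply: bin_fact; lia.
have Eba : ('C(m - a, b) * (b`! * (m - b - a)`!) = (m - a)`!)%N.
  by rewrite subnAC; apply: bin_fact; lia.
apply/eqP; transitivity (m`!).
  by rewrite -Eb -Eab; ring.
by rewrite -Ea -Eba; ring.
Qed.

Section BinTail.
Context {R : numFieldType}.

(** For s, N <= m this is the probability that a uniform [s]-subset of [m] points lies in a given
    set of [N] of them. *)
Definition bin_ratio (N m s : nat) : R := 'C(N, s)%:R / 'C(m, s)%:R.

Definition bin_tail (N m k : nat) : R :=
  \sum_(k <= s < m.+1) bin_ratio N m s / s%:R.

Lemma bin_ratioS (N m s : nat) : (s < m)%N ->
  bin_ratio N m s.+1 = bin_ratio N m s * ((N - s)%:R / (m - s)%:R).
Proof.
move=> sm; rewrite /bin_ratio.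
have := mul_bin_left N s; have := mul_bin_left m s.
move=> /(congr1 (fun x : nat => x%:R : R)); rewrite !natrM => Em.
move=> /(congr1 (fun x : nat => x%:R : R)); rewrite !natrM => EN.
have s0 : s.+1%:R != 0 :> R by rewrite pnatr_eq0.
have ms0 : (m - s)%:R != 0 :> R by rewrite pnatr_eq0; lia.
have C0 : 'C(m, s)%:R != 0 :> R by rewrite pnatr_eq0 -lt0n bin_gt0 ltnW.
have C1 : 'C(m, s.+1)%:R != 0 :> R by rewrite pnatr_eq0 -lt0n bin_gt0.
have -> : 'C(N, s.+1)%:R = (N - s)%:R * 'C(N, s)%:R / s.+1%:R :> R.
  by rewrite -EN mulrAC mulfV // mul1r.
have -> : 'C(m, s.+1)%:R = (m - s)%:R * 'C(m, s)%:R / s.+1%:R :> R.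
  by rewrite -Em mulrAC mulfV // mul1r.
by field; rewrite C0 ms0 addrC natr1 s0.
Qed.

(* Consecutive sums over [j] differ, by Pascal's rule and the hockey-stick
   identity, by exactly the term [s = k] of the tail. *)
Lemma sum_bin_ratio (m t k : nat) : (0 < t)%N -> (0 < k <= m.+1)%N ->
  \sum_(t <= j < m.+1) ('C(m.+1 - k, j)%:R / 'C(m, j)%:R / j%:R : R)
  = bin_tail (m.+1 - t) m k.
Proof.
move=> t0 /andP[k0 km].
(* Downward induction on [k], through d = m + 1 - k. At d = 0 the tail is empty, and the left side
   vanishes because every [j] is positive. *)
rewrite -(subKn km); set d := (m.+1 - k)%N.
have : (d <= m)%N by rewrite /d; lia.
elim: d => [|d IH] dm.
  rewrite subn0 subnn /bin_tail [RHS]big_geq // big_nat big1 // => j /andP[tj _].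
  by rewrite bin_small ?mul0r //; lia.
have dm' : (d < m)%N := dm.
rewrite /bin_tail subSS [RHS]big_ltn; last by lia.
have -> : (m - d).+1 = (m.+1 - d)%N by lia.
rewrite -/(bin_tail (m.+1 - t) m (m.+1 - d)) -IH; last by lia.
apply/eqP; rewrite -subr_eq -sumrB; apply/eqP.
rewrite (subKn (_ : (d.+1 <= m.+1)%N)); last by lia.
rewrite (subKn (_ : (d <= m.+1)%N)); last by lia.
set b := (m - d).-1.
have Eb : (m - d)%N = b.+1 by rewrite /b; lia.
clear k km k0 IH; case: m dm dm' @b Eb => [|m] dm dm' b Eb; first by [].
rewrite Eb.
have Cb : 'C(m, b)%:R != 0 :> R by rewrite pnatr_eq0 -lt0n bin_gt0; lia.
have m1 : m.+1%:R != 0 :> R by rewrite pnatr_eq0.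
(* Pascal's rule reduces the difference of numerators to 'C(d, j - 1), and absorption removes the
   factor 1/j. The trinomial swap then moves [j] out of the denominator into the upper index of a
   binomial with fixed lower index [b], which the hockey-stick identity sums. *)
transitivity (\sum_(t <= j < m.+2)
    'C(m.+1 - j, b)%:R / (m.+1%:R * 'C(m, b)%:R) : R).
  apply: eq_big_nat => j /andP[tj jm].
  case: j tj jm => [|a] tj jm; first by lia.
  have := mul_bin_diag m.+1 a => /= /(congr1 (fun x : nat => x%:R : R)).
  rewrite !natrM => Ea.
  have Ed : (m - b = d)%N by lia.
  have := mul_bin_trinom m a b ltac:(lia) ltac:(lia); rewrite Ed.
  move=> /(congr1 (fun x : nat => x%:R : R)); rewrite !natrM => Eab.
  have a1 : a.+1%:R != 0 :> R by rewrite pnatr_eq0.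
  have C2 : 'C(m, a)%:R != 0 :> R by rewrite pnatr_eq0 -lt0n bin_gt0.
  rewrite binS natrD subSS.
  have -> : 'C(m.+1, a.+1)%:R = m.+1%:R * 'C(m, a)%:R / a.+1%:R :> R.
    by rewrite Ea mulrAC mulfV // mul1r.
  have -> : 'C(m - a, b)%:R = 'C(d, a)%:R * 'C(m, b)%:R / 'C(m, a)%:R :> R.
    by rewrite Eab mulfK.
  by field; rewrite Cb C2 ![1 + _]addrC !natr1 m1 a1.
rewrite -mulr_suml -natr_sum (sum_bin_sub m.+2) /bin_ratio.
have := mul_bin_diag m.+1 b => /= /(congr1 (fun x : nat => x%:R : R)).
rewrite !natrM => ->.
by rewrite -mulrA invfM [_^-1 / _]mulrC.
Qed.

End BinTail.

(** * Logarithmic bounds on the threshold *)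

Section Threshold.
Context {R : realType}.

(** Both bounds are ln (1 + x) <= x, at x = -1/(n + 1) and at x = 1/n. *)
Lemma ln_succ_sub (n : nat) : (0 < n)%N ->
  n.+1%:R^-1 <= ln (n.+1%:R : R) - ln n%:R <= n%:R^-1.
Proof.
move=> n0; have n0' : 0 < n%:R :> R by rewrite ltr0n.
have n1 : 0 < n.+1%:R :> R by rewrite ltr0n.
have E : n.+1%:R = n%:R + 1 :> R by rewrite natr1.
apply/andP; split.
  have -> : ln n.+1%:R - ln n%:R = - ln (1 + (- n.+1%:R^-1)) :> R.
    rewrite -opprB -ln_div ?posrE //; congr (- ln _).
    by rewrite E; field; rewrite -E gt_eqF.
  rewrite lerNr; apply: le_ln1Dx; rewrite ltrN2 invf_lt1 // ltr1n ltnS //.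
have -> : ln n.+1%:R - ln n%:R = ln (1 + n%:R^-1) :> R.
  rewrite -ln_div ?posrE //; congr (ln _).
  by rewrite E; field; rewrite gt_eqF.
apply: le_ln1Dx; apply: lt_trans (_ : 0 < _); first by rewrite ltrN10.
by rewrite invr_gt0.
Qed.

Lemma ln_le_harmonic (t n : nat) : (0 < t <= n)%N ->
  ln n%:R - ln t%:R <= \sum_(t <= s < n) s%:R^-1 :> R.
Proof.
move=> /andP[t0]; elim: n => [|n IH] tn; first by lia.
have [->|tn'] := eqVneq t n.+1; first by rewrite subrr big_geq.
have {}tn : (t <= n)%N by lia.
have /andP[_ H] := ln_succ_sub n ltac:(lia).
rewrite big_nat_recr //= -(subrKA (ln n%:R)) [leLHS]addrC.
by apply: lerD => //; apply: IH.
Qed.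

Lemma harmonic_le_ln (t n : nat) : (0 < t <= n)%N ->
  \sum_(t.+1 <= s < n.+1) s%:R^-1 <= ln n%:R - ln t%:R :> R.
Proof.
move=> /andP[t0]; elim: n => [|n IH] tn; first by lia.
have [->|tn'] := eqVneq t n.+1; first by rewrite subrr big_geq.
have {}tn : (t <= n)%N by lia.
have /andP[H _] := ln_succ_sub n ltac:(lia).
rewrite big_nat_recr //= -[leRHS](subrKA (ln n%:R)) [leRHS]addrC.
by apply: lerD => //; apply: IH.
Qed.

Lemma threshold_gt0 (n : nat) : (0 < threshold R n)%N.
Proof. by rewrite /threshold; case: ex_minnP => t /andP[]. Qed.

Lemma sum_threshold_le1 (n : nat) :
  \sum_(threshold R n <= s < n) s%:R^-1 <= 1 :> R.
Proof. by rewrite /threshold; case: ex_minnP => t /andP[]. Qed.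

Lemma sum_threshold_pred_gt1 (n : nat) : (1 < threshold R n)%N ->
  1 < \sum_((threshold R n).-1 <= s < n) s%:R^-1 :> R.
Proof.
rewrite /threshold; case: ex_minnP => t _ min_t t1.
rewrite ltNge; apply/negP => le1.
have /min_t : threshold_pred R n t.-1 by rewrite /threshold_pred le1 andbT; lia.
by lia.
Qed.

Lemma expR_ln_le (x y c : R) : 0 < x -> 0 < y -> ln x - ln y <= c ->
  x <= expR c * y.
Proof.
move=> x0 y0 xy; rewrite -(lnK (_ : y \is Num.pos)) // -expRD.
rewrite -[leLHS](lnK (_ : x \is Num.pos)) // ler_expR; lra.
Qed.

Lemma threshold_ge (n : nat) : n%:R / expR 1 <= (threshold R n)%:R :> R.
Proof.
have e1 : 1 < expR 1 :> R by rewrite expR_gt1.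
have e0 : 0 < expR 1 :> R by exact: expR_gt0.
have t0 := threshold_gt0 n; rewrite ler_pdivrMr // mulrC.
have [tn|nt] := leqP (threshold R n) n.
  apply: expR_ln_le; rewrite ?ltr0n //; first by lia.
  apply: le_trans (ln_le_harmonic _ _ _) (sum_threshold_le1 n).
  by rewrite t0.
have : n%:R <= (threshold R n)%:R :> R by rewrite ler_nat ltnW.
by have : 0 <= (threshold R n)%:R :> R by []; nra.
Qed.

(** By minimality the harmonic sum from t_n - 1 exceeds 1. Comparing it with a logarithm lowers the
    starting point once more, to t_n - 2, whence the constant 2. Thresholds up to 2 are set apart so
    that the logarithm has a positive argument. *)
Lemma threshold_le (n : nat) : (threshold R n)%:R <= n%:R / expR 1 + 2 :> R.
Proof.
have e0 : 0 < expR 1 :> R by exact: expR_gt0.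
have ne0 : 0 <= n%:R / expR 1 :> R by rewrite divr_ge0 // ltW.
have [t2|t2] := leqP (threshold R n) 2.
  have : (threshold R n)%:R <= 2 :> R by rewrite ler_nat.
  by lra.
have := @sum_threshold_pred_gt1 n ltac:(lia).
case: n ne0 t2 => [|n] ne0 t2; first by rewrite big_geq // ltr10.
have -> : (threshold R n.+1).-1 = (threshold R n.+1).-2.+1 by lia.
have [tn|nt] := leqP (threshold R n.+1).-2.+1 n; last first.
  by rewrite big_geq // ltr10.
move=> /lt_le_trans/(_ (harmonic_le_ln (threshold R n.+1).-2 n ltac:(lia))) Hln.
have {Hln} : (threshold R n.+1).-2%:R <= expR (-1) * n%:R :> R.
  by apply: expR_ln_le; rewrite ?ltr0n; [lia|lia|lra].
rewrite expRN mulrC.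
have : n%:R / expR 1 <= n.+1%:R / expR 1 :> R.
  by rewrite ler_pM2r ?invr_gt0 // ler_nat.
have -> : (threshold R n.+1)%:R = (threshold R n.+1).-2%:R + 2 :> R.
  by rewrite -natrD; congr _%:R; lia.
by move=> A B; have := le_trans B A; lra.
Qed.

End Threshold.

(** * Geometric bounds on the tails *)

Section TailBounds.
Context {R : realFieldType}.

Lemma bin_ratio_ge0 (N m s : nat) : 0 <= bin_ratio N m s :> R.
Proof. by rewrite /bin_ratio divr_ge0. Qed.

Lemma bin_tail_ge0 (N m k : nat) : 0 <= bin_tail N m k :> R.
Proof. by apply: sumr_ge0 => s _; rewrite divr_ge0 ?bin_ratio_ge0. Qed.

Lemma bin_tailS (N m k : nat) : (k <= m)%N ->
  bin_tail N m k = bin_ratio N m k / k%:R + bin_tail N m k.+1 :> R.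
Proof. by move=> km; rewrite /bin_tail big_ltn. Qed.

(** The ratio is a product of [s] factors (N - i) / (m - i), each at most [r] because N <= r m and r
    <= 1. *)
Lemma bin_ratio_le (N m s : nat) (r : R) : 0 <= r <= 1 ->
  N%:R <= r * m%:R -> (s <= m)%N -> bin_ratio N m s <= r ^+ s.
Proof.
move=> /andP[r0 r1] Nm; elim: s => [|s IH] sm.
  by rewrite /bin_ratio !bin0 divr1 expr0.
rewrite bin_ratioS // exprSr ler_pM ?bin_ratio_ge0 ?divr_ge0 //.
  by apply: IH; lia.
have ms : 0 < (m - s)%:R :> R by rewrite ltr0n subn_gt0.
rewrite ler_pdivrMr //.
have [Ns|sN] := leqP N s; first by rewrite (eqP Ns) mulr_ge0 // ltW.
rewrite !natrB; [|lia|lia].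
have : 0 <= s%:R :> R by []; move: Nm r0 r1; nra.
Qed.

Lemma sum_expr_le (r : R) (k n : nat) : 0 <= r < 1 ->
  \sum_(k <= s < n) r ^+ s <= r ^+ k / (1 - r).
Proof.
move=> /andP[r0 r1]; have r1' : 0 < 1 - r by lra.
rewrite ler_pdivlMr //.
have [nk|kn] := leqP n k; first by rewrite big_geq // mul0r exprn_ge0.
suff -> : (\sum_(k <= s < n) r ^+ s) * (1 - r) = r ^+ k - r ^+ n.
  by rewrite lerBlDr lerDl exprn_ge0.
rewrite mulr_suml; under eq_bigr do rewrite mulrBr mulr1 -exprSr.
by rewrite -[LHS]opprK -sumrN; under eq_bigr do rewrite opprB;
   rewrite telescope_sumr ?opprB // ltnW.
Qed.

Lemma bin_tail_le (N m k : nat) (r : R) : 0 <= r < 1 ->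
  N%:R <= r * m%:R -> (0 < k)%N -> bin_tail N m k <= r ^+ k / (1 - r).
Proof.
move=> /andP[r0 r1] Nm k0.
apply: le_trans (_ : _ <= \sum_(k <= s < m.+1) r ^+ s) (sum_expr_le _ _ _ _).
  rewrite /bin_tail !big_nat; apply: ler_sum => s /andP[ks sm].
  rewrite -[leRHS]mulr1 ler_pM ?bin_ratio_ge0 ?invr_ge0 //.
    by apply: bin_ratio_le => //; rewrite ?r0 ?ltW.
  by rewrite invf_le1 ?ler1n ?ltr0n; lia.
by rewrite r0.
Qed.

End TailBounds.

(** * Limits of the tails for a fixed rank *)

Section Limits.
Context {R : realType} (q : R) (N : nat -> nat).
Hypothesis q01 : 0 < q < 1.
Hypothesis cvgN : (N m)%:R / m%:R @[m --> \oo] --> q.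

Lemma cvg_invn : (m%:R^-1 : R) @[m --> \oo] --> 0.
Proof.
apply/(gtr0_cvgV0 _).2; last exact: cvgr_idn.
by near=> m; rewrite ltr0n; near: m; exact: nbhs_infty_gt.
Unshelve. all: by end_near. Qed.

Lemma cvg_divn (c : R) : c / m%:R @[m --> \oo] --> 0.
Proof. by rewrite -(mulr0 c); apply: cvgMl_tmp; exact: cvg_invn. Qed.

Lemma near_N_gt (s : nat) : \forall m \near \oo, (s < N m)%N.
Proof.
have /andP[q0 _] := q01.
have h : (N m)%:R / m%:R - s%:R / m%:R @[m --> \oo] --> q - 0.
  by apply: cvgB => //; exact: cvg_divn.
rewrite subr0 in h.
near=> m.
have m0 : (0 < m)%N by near: m; exact: nbhs_infty_gt.
have : 0 < (N m)%:R / m%:R - s%:R / m%:R :> R by near: m; exact: (cvgr_gt q h 0 q0).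
by rewrite -mulrBl pmulr_lgt0 ?invr_gt0 ?ltr0n // subr_gt0 ltr_nat.
Unshelve. all: by end_near. Qed.

Lemma cvg_ratio_sub (s s' : nat) :
  (N m - s)%:R / (m - s')%:R @[m --> \oo] --> q.
Proof.
have h : ((N m)%:R / m%:R - s%:R / m%:R) / (1 - s'%:R / m%:R) @[m --> \oo]
    --> (q - 0) / (1 - 0).
  apply: cvgM; first by apply: cvgB => //; exact: cvg_divn.
  apply: cvgV; first by rewrite subr0 oner_eq0.
  by apply: cvgB; [exact: cvg_cst|exact: cvg_divn].
rewrite !subr0 divr1 in h; apply: cvg_trans h; apply: near_eq_cvg.
near=> m.
have sN : (s < N m)%N by near: m; exact: near_N_gt.
have sm : (s' < m)%N by near: m; exact: nbhs_infty_gt.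
rewrite !natrB ?(ltnW sN) ?(ltnW sm) //.
have m0 : m%:R != 0 :> R by rewrite pnatr_eq0; lia.
have ms0 : m%:R - s'%:R != 0 :> R by rewrite subr_eq0 eqr_nat; lia.
by field; rewrite ?m0 ?ms0.
Unshelve. all: by end_near. Qed.

Lemma cvg_bin_ratio (s : nat) : bin_ratio (N m) m s @[m --> \oo] --> q ^+ s.
Proof.
elim: s => [|s IH].
  rewrite expr0; under eq_fun do rewrite /bin_ratio !bin0 divr1.
  exact: cvg_cst.
have h : bin_ratio (N m) m s * ((N m - s)%:R / (m - s)%:R) @[m --> \oo]
    --> q ^+ s * q.
  by apply: cvgM => //; exact: cvg_ratio_sub.
rewrite exprSr; apply: cvg_trans h; apply: near_eq_cvg.
near=> m; rewrite /= bin_ratioS //.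
by near: m; exact: nbhs_infty_gt.
Unshelve. all: by end_near. Qed.

Hypothesis cvg_tail1 : bin_tail (N m) m 1 @[m --> \oo] --> (1 : R).

(** The tail a_k written with a finite sum: the value 1 of the whole series enters through
    [cvg_tail1], and [log_rest_series] recovers the infinite sum. *)
Definition log_rest (k : nat) : R := 1 - \sum_(1 <= s < k) q ^+ s / s%:R.

Lemma log_restS (k : nat) : (0 < k)%N ->
  log_rest k = q ^+ k / k%:R + log_rest k.+1.
Proof. by move=> k0; rewrite /log_rest big_nat_recr //=; ring. Qed.

Lemma cvg_bin_tail (k : nat) : (0 < k)%N ->
  bin_tail (N m) m k @[m --> \oo] --> log_rest k.
Proof.
elim: k => [//|[_ _|k /(_ isT) IH _]]; first by rewrite /log_rest big_geq ?subr0.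
have -> : log_rest k.+2 = log_rest k.+1 - q ^+ k.+1 / k.+1%:R.
  by rewrite (log_restS k.+1) // addrAC subrr add0r.
have h : bin_tail (N m) m k.+1 - bin_ratio (N m) m k.+1 / k.+1%:R @[m --> \oo]
    --> log_rest k.+1 - q ^+ k.+1 / k.+1%:R.
  by apply: cvgB => //; apply: cvgMr_tmp; exact: cvg_bin_ratio.
apply: cvg_trans h; apply: near_eq_cvg; near=> m.
have km : (k.+1 <= m)%N by near: m; exact: nbhs_infty_ge.
by rewrite (@bin_tailS R (N m) m k.+1 km) addrAC subrr add0r.
Unshelve. all: by end_near. Qed.

Lemma near_N_le (r : R) : q < r -> \forall m \near \oo, (N m)%:R <= r * m%:R.
Proof.
move=> qr; near=> m.
have m0 : (0 < m)%N by near: m; exact: nbhs_infty_gt.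
have : (N m)%:R / m%:R < r by near: m; exact: (cvgr_lt q cvgN r qr).
by rewrite ltr_pdivrMr ?ltr0n // => /ltW.
Unshelve. all: by end_near. Qed.

Lemma log_rest_ge0 (k : nat) : (0 < k)%N -> 0 <= log_rest k.
Proof.
move=> k0; apply: (cvgr_to_ge (cvg_bin_tail k k0)).
by apply: nearW => m; exact: bin_tail_ge0.
Qed.

Lemma log_rest_gt0 (k : nat) : (0 < k)%N -> 0 < log_rest k.
Proof.
move=> k0; rewrite log_restS // ltr_pwDl ?log_rest_ge0 //.
by have /andP[q0 _] := q01; rewrite divr_gt0 ?exprn_gt0 ?ltr0n.
Qed.

(** The geometric bound on [bin_tail] holds for all large [m] with the same [r], so it survives the
    limit in [m]. The result amounts to the identity \sum_(s >= 1) q^s/s = 1, reached without the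
    power series of the logarithm. *)
Lemma cvg_log_rest : log_rest k @[k --> \oo] --> 0.
Proof.
have /andP[q0 q1] := q01.
pose r := (1 + q) / 2; have qr : q < r by rewrite /r; lra.
have r01 : 0 <= r < 1 by rewrite /r; apply/andP; split; lra.
have h : r ^+ k / (1 - r) @[k --> \oo] --> 0.
  rewrite -(mul0r (1 - r)^-1); apply: cvgMr_tmp; apply: cvg_expr.
  by move: r01 => /andP[r0 r1]; rewrite ger0_norm.
apply: squeeze_cvgr (cvg_cst 0) h; near=> k.
have k0 : (0 < k)%N by near: k; exact: nbhs_infty_gt.
rewrite log_rest_ge0 //=; apply: (cvgr_to_le (cvg_bin_tail k k0)).
by have := near_N_le r qr; apply: filterS => m Nm; exact: bin_tail_le.
Unshelve. all: by end_near. Qed.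

Lemma log_rest_series (m : nat) : (0 < m)%N ->
  \big[+%R/0]_(m <= s <oo) (s%:R^-1 * q ^+ s) = log_rest m.
Proof.
move=> m0; apply: cvg_lim => //.
have h : log_rest m - log_rest n @[n --> \oo] --> log_rest m - 0.
  by apply: cvgB; [exact: cvg_cst|exact: cvg_log_rest].
rewrite subr0 in h; apply: cvg_trans h; apply: near_eq_cvg.
near=> n; have mn : (m <= n)%N by near: n; exact: nbhs_infty_ge.
rewrite /= /log_rest (@big_cat_nat _ _ _ m 1 n) //=.
under [in RHS]eq_bigr do rewrite mulrC.
ring.
Unshelve. all: by end_near. Qed.

End Limits.

(** * Monotonicity in [k] of the ratio b (k + l) / b k *)

Section LogTail.
Context {R : realType} (q : R) (b : nat -> R) (l : nat).
Hypothesis q01 : 0 < q < 1.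
Hypothesis bS : forall k : nat, (0 < k)%N -> b k = q ^+ k / k%:R + b k.+1.
Hypothesis cvg_b : b k @[k --> \oo] --> 0.
Hypothesis l_gt0 : (0 < l)%N.

(** Reduces an inequality between two tails to one between their terms: the difference tends to 0,
    so it is enough that it decreases at each step. *)
Lemma nonincreasing_cvg0_ge0 (u : nat -> R) :
  (forall k, (0 < k)%N -> u k.+1 <= u k) -> u k @[k --> \oo] --> 0 ->
  forall k, (0 < k)%N -> 0 <= u k.
Proof.
move=> du cu k k0; have le_u n : (k <= n)%N -> u n <= u k.
  elim: n => [|n IH] kn; first by have -> : k = 0%N by lia.
  have [->//|kn'] := eqVneq k n.+1.
  by apply: le_trans (du _ _) (IH _); lia.
apply: (cvgr_to_le cu); near=> n; apply: le_u.
by near: n; exact: nbhs_infty_ge.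
Unshelve. all: by end_near. Qed.

Lemma rest_term_gt0 (k : nat) : (0 < k)%N -> 0 < q ^+ k / k%:R.
Proof.
have /andP[q0 _] := q01.
by move=> k0; rewrite divr_gt0 ?exprn_gt0 ?ltr0n.
Qed.

Lemma rest_gt0 (k : nat) : (0 < k)%N -> 0 < b k.
Proof.
move=> k0; rewrite bS // ltr_pwDl ?rest_term_gt0 //.
apply: nonincreasing_cvg0_ge0 => // j j0.
by rewrite [b j]bS // lerDr ltW ?rest_term_gt0.
Qed.

(** The quotient of the series term of index k + l by the one of index k. *)
Let rho (k : nat) : R := q ^+ l * (k%:R / (k + l)%:R).

Lemma cvg_rest_add : b (k + l)%N @[k --> \oo] --> 0.
Proof. by rewrite (cvg_shiftn l b). Qed.

Lemma rho_bounds (k : nat) : 0 <= rho k <= 1.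
Proof.
have /andP[q0 q1] := q01.
rewrite /rho mulr_ge0 ?exprn_ge0 ?divr_ge0 ?(ltW q0) //=.
rewrite mulr_ile1 ?exprn_ge0 ?divr_ge0 ?exprn_ile1 ?(ltW q0) ?(ltW q1) //.
by rewrite ler_pdivrMr ?ltr0n ?mul1r ?ler_nat; lia.
Qed.

Lemma rho_lt (k : nat) : rho k < rho k.+1.
Proof.
have /andP[q0 _] := q01.
rewrite /rho ltr_pM2l ?exprn_gt0 // ltr_pdivlMr ?ltr0n; last by lia.
rewrite mulrAC ltr_pdivrMr ?ltr0n; last by lia.
by rewrite -!natrM ltr_nat; nia.
Qed.

Lemma cvg_rhoM : rho k * b k @[k --> \oo] --> 0.
Proof.
apply: squeeze_cvgr (cvg_cst 0) cvg_b; near=> k.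
have k0 : (0 < k)%N by near: k; exact: nbhs_infty_gt.
have /andP[r0 r1] := rho_bounds k; have bk := ltW (rest_gt0 k k0).
by rewrite mulr_ge0 //= ler_piMl.
Unshelve. all: by end_near. Qed.

Lemma rhoM_term (k : nat) : (0 < k)%N ->
  rho k * (q ^+ k / k%:R) = q ^+ (k + l) / (k + l)%:R.
Proof.
move=> k0; rewrite /rho exprD.
have k1 : k%:R != 0 :> R by rewrite pnatr_eq0; lia.
have kl : (k + l)%:R != 0 :> R by rewrite pnatr_eq0; lia.
by field; rewrite -natrD kl k1.
Qed.

(* [b (k + l)] is the [rho]-weighted version of the series [b k], and [rho]
   increases, so its weighted mean over [s >= k] exceeds [rho k]. *)
Lemma rhoM_lt (k : nat) : (0 < k)%N -> rho k * b k < b (k + l)%N.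
Proof.
pose x k := b (k + l)%N - rho k * b k.
(* Summation by parts: in x j - x (j + 1) the series terms cancel and only the increment of [rho] is
   left. *)
have xS j : (0 < j)%N -> x j = x j.+1 + (rho j.+1 - rho j) * b j.+1.
  move=> j0; rewrite /x [b j]bS // [b (j + l)%N]bS; last by lia.
  by rewrite mulrDr rhoM_term // addSn; ring.
have x0 j : (0 < j)%N -> 0 <= x j.
  apply: nonincreasing_cvg0_ge0 => [i i0|].
    by rewrite [x i]xS // lerDl mulr_ge0 ?subr_ge0 ?ltW ?rho_lt ?rest_gt0.
  rewrite -(subrr (0 : R)).
  by apply: cvgB; [exact: cvg_rest_add|exact: cvg_rhoM].
move=> k0; rewrite -subr_gt0 -/(x k) xS // ltr_wpDl ?x0 //.
by rewrite mulr_gt0 ?subr_gt0 ?rho_lt ?rest_gt0.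
Qed.

(** After cross-multiplication the difference is the [k]-th term times b (k + l) - rho k * b k,
    which [rhoM_lt] makes positive. *)
Lemma rest_ratio_lt (k : nat) : (0 < k)%N ->
  b (k + l)%N / b k < b (k.+1 + l)%N / b k.+1.
Proof.
move=> k0; have bk := rest_gt0 k k0; have bk1 := rest_gt0 k.+1 isT.
rewrite ltr_pdivrMr // mulrAC ltr_pdivlMr //.
have Ek := bS k k0.
have Ekl : b (k.+1 + l)%N = b (k + l)%N - rho k * (q ^+ k / k%:R).
  by rewrite rhoM_term // [b (k + l)%N]bS ?addSn; [ring|lia].
rewrite -subr_gt0.
have -> : b (k.+1 + l)%N * b k - b (k + l)%N * b k.+1
    = q ^+ k / k%:R * (b (k + l)%N - rho k * b k).
  by rewrite Ekl Ek; ring.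
by rewrite mulr_gt0 ?rest_term_gt0 ?subr_gt0 ?rhoM_lt.
Qed.

Lemma rest_ratio_mono (j k : nat) : (0 < j <= k)%N ->
  b (j + l)%N / b j <= b (k + l)%N / b k.
Proof.
move=> /andP[j0]; elim: k => [|k IH] jk; first by lia.
have [->//|jk'] := eqVneq j k.+1.
have {}jk : (j <= k)%N by lia.
by apply: le_trans (IH jk) (ltW (rest_ratio_lt _ _)); lia.
Qed.

(** Termwise this is [rho] <= q^l. It ensures q^l B > 1 for any B above b 2 / b (2 + l). *)
Lemma rest_ratio_le (k : nat) : (0 < k)%N -> b (k + l)%N <= q ^+ l * b k.
Proof.
have /andP[q0 _] := q01.
move=> k0; rewrite -subr_ge0.
apply: (nonincreasing_cvg0_ge0 (fun k => q ^+ l * b k - b (k + l)%N)) => //.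
  move=> j j0; rewrite [b j]bS // [b (j + l)%N]bS; last by lia.
  rewrite -rhoM_term // /rho addSn.
  have h : 0 <= 1 - j%:R / (j + l)%:R :> R.
    by rewrite subr_ge0 ler_pdivrMr ?ltr0n ?mul1r ?ler_nat; lia.
  rewrite -subr_ge0; set lhs := (X in 0 <= X).
  have -> : lhs = q ^+ l * (q ^+ j / j%:R) * (1 - j%:R / (j + l)%:R).
    by rewrite /lhs; ring.
  by rewrite mulr_ge0 // mulr_ge0 ?exprn_ge0 ?(ltW q0) ?ltW ?rest_term_gt0.
rewrite -(subrr (0 : R)) -{1}(mulr0 (q ^+ l)).
by apply: cvgB; [exact: cvgMl_tmp|exact: cvg_rest_add].
Qed.

End LogTail.

(** * Comparison of a tail with its shift, uniformly in the rank *)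

Section BinTailShift.
Context {R : realFieldType}.

(** Each of the [l] additional factors has numerator at least N - (s + l) >= p m and denominator at
    most [m]. *)
Lemma bin_ratio_shift_ge (N m s l : nat) (p : R) : 0 <= p -> (s + l <= m)%N ->
  p * m%:R + (s + l)%:R <= N%:R ->
  p ^+ l * bin_ratio N m s <= bin_ratio N m (s + l).
Proof.
move=> p0; elim: l => [|l IH] slm pN; first by rewrite mul1r addn0.
have pN' : p * m%:R + (s + l)%:R <= N%:R.
  by apply: le_trans pN; rewrite lerD2l ler_nat leq_add2l.
rewrite addnS bin_ratioS; last by lia.
rewrite exprSr mulrAC; apply: ler_pM => //.
- by rewrite mulr_ge0 ?exprn_ge0 ?bin_ratio_ge0.
- by apply: IH => //; lia.
have m0 : 0 <= p * m%:R by rewrite mulr_ge0.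
have slN : (s + l <= N)%N by rewrite -(ler_nat R); lra.
rewrite ler_pdivlMr ?ltr0n; last by lia.
rewrite (natrB _ slN) lerBrDr; apply: le_trans pN'; rewrite lerD2r.
by rewrite ler_wpM2l // ler_nat leq_subr.
Qed.

Lemma bin_tail_anti (N m j k : nat) : (j <= k)%N ->
  bin_tail N m k <= bin_tail N m j :> R.
Proof.
move=> jk; have [km|mk] := leqP k m.+1; last first.
  by rewrite /bin_tail big_geq ?bin_tail_ge0 // ltnW.
rewrite /bin_tail (@big_cat_nat _ _ _ k j m.+1) //= lerDr.
by apply: sumr_ge0 => s _; rewrite divr_ge0 ?bin_ratio_ge0.
Qed.

(** Cut at [M]: terms below [M] are compared one by one with the terms [l] places further, and the
    terms from [M] on are kept as an error. *)
Lemma bin_tail_shift (N m k M l : nat) (B : R) :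
  (0 < k)%N -> (M + l <= m.+1)%N -> 0 <= B ->
  (forall s, (k <= s < M)%N ->
     bin_ratio N m s / s%:R <= B * (bin_ratio N m (s + l) / (s + l)%:R)) ->
  bin_tail N m k <= B * bin_tail N m (k + l) + bin_tail N m M.
Proof.
move=> k0 Mm B0 H.
have [kM|Mk] := leqP k M; last first.
  apply: le_trans (bin_tail_anti _ _ _ _ (ltnW Mk)) _.
  by rewrite lerDr mulr_ge0 ?bin_tail_ge0.
rewrite {1}/bin_tail (@big_cat_nat _ _ _ M k m.+1) //=; last by lia.
rewrite -/(bin_tail N m M) lerD2r.
apply: le_trans (_ : _ <= B * \sum_(k + l <= s < M + l)
  (bin_ratio N m s / s%:R)) _.
  rewrite big_addn addnK mulr_sumr !big_nat; apply: ler_sum => s; exact: H.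
rewrite ler_wpM2l // /bin_tail (@big_cat_nat _ _ _ (M + l) (k + l) m.+1) //=.
  by rewrite lerDl; apply: sumr_ge0 => s _; rewrite divr_ge0 ?bin_ratio_ge0.
by rewrite leq_add2r.
Qed.

End BinTailShift.

Section LargeRank.
Context {R : realType} (q : R) (N : nat -> nat).
Hypothesis q01 : 0 < q < 1.
Hypothesis cvgN : (N m)%:R / m%:R @[m --> \oo] --> q.

(** With x = (1 - r) M / 2, r <= exp (r - 1) gives r^M <= exp (-2 x), and exp x >= x bounds this by
    1/x^2. *)
Lemma expr_le_invn2 (r : R) (M : nat) : 0 <= r < 1 -> (0 < M)%N ->
  r ^+ M <= 4 / ((1 - r) ^+ 2 * M%:R ^+ 2).
Proof.
move=> /andP[r0 r1] M0; pose x := (1 - r) * M%:R / 2.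
have c0 : 0 < 1 - r by lra.
have Mr0 : 0 < M%:R :> R by rewrite ltr0n.
have x0 : 0 < x by rewrite /x !mulr_gt0 ?invr_gt0.
have -> : 4 / ((1 - r) ^+ 2 * M%:R ^+ 2) = (x ^+ 2)^-1.
  by rewrite /x; field; rewrite !gt_eqF.
apply: le_trans (_ : _ <= (expR x ^+ 2)^-1) _; last first.
  rewrite lef_pV2 ?posrE ?exprn_gt0 ?expR_gt0 // lerXn2r ?nnegrE ?expR_ge0 ?ltW //.
  by apply: lt_le_trans (expR_ge1Dx x); rewrite ltrDr.
rewrite -expRM_natl -expRN.
have -> : - (2%:R * x) = M%:R * (r - 1) by rewrite /x; field.
rewrite expRM_natl lerXn2r ?nnegrE ?expR_ge0 //.
by apply: le_trans (expR_ge1Dx _); rewrite addrC subrK.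
Qed.

(** Since m <= 2 h M for M = m %/ h, the inverse-square bound on r^M leaves a constant over [M]
    after multiplication by [m]. *)
Lemma near_mulM_expr_le (r e : R) (h : nat) : 0 <= r < 1 -> 0 < e -> (0 < h)%N ->
  \forall m \near \oo, r ^+ (m %/ h) * m%:R <= e.
Proof.
move=> r01 e0 h0; have /andP[r0 r1] := r01.
have c0 : 0 < (1 - r) ^+ 2 by rewrite exprn_gt0 //; lra.
pose C : R := 8 * h%:R / ((1 - r) ^+ 2 * e).
have [J CJ] : exists J : nat, C < J%:R.
  exists (Num.bound C); apply: archi_boundP.
  rewrite /C; apply: divr_ge0; first exact: mulr_ge0.
  by apply: mulr_ge0; apply: ltW.
near=> m; set M := (m %/ h)%N.
have hJ : (h * J.+1 <= m)%N by near: m; exact: nbhs_infty_ge.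
have JM : (J < M)%N by rewrite /M leq_divRL // mulnC.
have M0 : (0 < M)%N by lia.
have mM : (m <= 2 * h * M)%N.
  have := divn_eq m h; have := ltn_pmod m h0; rewrite -/M; nia.
have Mr0 : 0 < M%:R :> R by rewrite ltr0n.
apply: le_trans (_ : _ <= 4 / ((1 - r) ^+ 2 * M%:R ^+ 2) * (2 * h * M)%:R) _.
  by apply: ler_pM; rewrite ?exprn_ge0 ?expr_le_invn2 ?ler_nat.
have -> : 4 / ((1 - r) ^+ 2 * M%:R ^+ 2) * (2 * h * M)%:R
    = 8 * h%:R / ((1 - r) ^+ 2 * M%:R) :> R.
  by rewrite !natrM; field; rewrite !gt_eqF // subr_gt0.
have : C < M%:R by apply: lt_trans CJ _; rewrite ltr_nat.
rewrite /C ltr_pdivrMr ?(mulr_gt0 c0 e0) // => /ltW CM.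
rewrite ler_pdivrMr ?(mulr_gt0 c0 Mr0) //; apply: le_trans CM _.
by rewrite le_eqVlt; apply/orP; left; apply/eqP; ring.
Unshelve. all: by end_near. Qed.

Lemma near_N_ge (r : R) : r < q -> \forall m \near \oo, r * m%:R <= (N m)%:R.
Proof.
move=> qr; near=> m.
have m0 : (0 < m)%N by near: m; exact: nbhs_infty_gt.
have : r < (N m)%:R / m%:R by near: m; exact: (cvgr_gt q cvgN r qr).
by rewrite ltr_pdivlMr ?ltr0n // => /ltW.
Unshelve. all: by end_near. Qed.

(** The order of quantifiers is the point: one range of [m] serves all k >= K. The allowed error (B
    - 1) / m is the excess of B / m over 1 / m, coming from the summand 1/(n - 1) of r_{k,n}. *)
Lemma near_tail_le_large (p B : R) (K l : nat) :
  0 < p < q -> 1 < B -> (0 < K)%N ->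
  1 <= p ^+ l * (K%:R / (K + l)%:R) * B ->
  \forall m \near \oo, forall k, (K <= k)%N ->
    bin_tail (N m) m k <= B * bin_tail (N m) m (k + l) + (B - 1) / m%:R.
Proof.
move=> /andP[p0 pq] B1 K0 pKB; have /andP[q0 q1] := q01.
pose r := (1 + q) / 2; have qr : q < r by rewrite /r; lra.
have r01 : 0 <= r < 1 by rewrite /r; apply/andP; split; lra.
have r1' : 0 < 1 - r by case/andP: r01; lra.
(* The gap between [p] and [q] is split in three: for N/m falling short of [q], for the cutoff M/m,
   and for l/m. *)
pose dl := (q - p) / 3; have dl0 : 0 < dl by rewrite /dl; lra.
have [h h0 hdl] : exists2 h : nat, (0 < h)%N & h%:R^-1 <= dl.
  exists (Num.bound dl^-1).+1 => //.
  rewrite -[leRHS]invrK lef_pV2 ?posrE ?invr_gt0 //.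
  apply: ltW; apply: lt_trans (_ : _ < (Num.bound dl^-1)%:R) _.
    by apply: archi_boundP; rewrite invr_ge0 ltW.
  by rewrite ltr_nat.
have [J lJ] : exists J : nat, l%:R / dl < J%:R.
  by exists (Num.bound (l%:R / dl)); apply: archi_boundP; rewrite divr_ge0 // ltW.
have B0 : 0 < B := lt_trans ltr01 B1.
have dl1 : dl + dl <= 1 by rewrite /dl; lra.
have pdl : p + dl + dl = q - dl by rewrite /dl; field.
have qdl : q - dl < q by rewrite ltrBlDr ltrDl.
have Br0 : 0 < (B - 1) * (1 - r) by rewrite mulr_gt0 // subr_gt0.
near=> m.
have NqM : (q - dl) * m%:R <= (N m)%:R.
  by near: m; exact: (near_N_ge (q - dl) qdl).
have Nr : (N m)%:R <= r * m%:R by near: m; exact: (near_N_le q N cvgN r qr).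
have rM : r ^+ (m %/ h) * m%:R <= (B - 1) * (1 - r).
  by near: m; exact: (near_mulM_expr_le r _ h r01 Br0 h0).
have M0 : (0 < m %/ h)%N by rewrite divn_gt0 //; near: m; exact: nbhs_infty_ge.
have mJ : (J + l.*2 + 2 < m)%N by near: m; exact: nbhs_infty_gt.
have m0 : 0 < m%:R :> R by rewrite ltr0n; exact: leq_ltn_trans mJ.
have ldl : l%:R <= dl * m%:R.
  rewrite mulrC -ler_pdivrMr //; apply: ltW; apply: lt_trans lJ _.
  by rewrite ltr_nat; clear -mJ; lia.
set M := (m %/ h)%N in rM M0 *.
have Mdl : M%:R <= dl * m%:R.
  apply: le_trans (_ : _ <= h%:R^-1 * m%:R) _; last by rewrite ler_wpM2r // ltW.
  by rewrite mulrC ler_pdivlMr ?ltr0n // -natrM ler_nat leq_trunc_div.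
have pMN : p * m%:R + (M + l)%:R <= (N m)%:R.
  rewrite natrD; apply: le_trans NqM.
  apply: le_trans (_ : _ <= (p + dl + dl) * m%:R) _.
    by rewrite !mulrDl -addrA lerD2l lerD.
  by rewrite pdl.
have Mlm : (M + l <= m)%N.
  rewrite -(ler_nat R) natrD; apply: le_trans (lerD Mdl ldl) _.
  by rewrite -mulrDl ler_piMl // ltW.
move=> k Kk.
have tailM : bin_tail (N m) m M <= (B - 1) / m%:R.
  apply: le_trans (bin_tail_le _ _ _ r r01 Nr M0) _.
  by rewrite ler_pdivrMr // mulrAC ler_pdivlMr.
apply: le_trans (bin_tail_shift _ _ k M l B _ _ _ _) _; last by rewrite lerD2l.
- exact: leq_trans K0 Kk.
- exact: leqW.
- exact: ltW.
move=> s /andP[ks sM].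
have s0 : (0 < s)%N := leq_trans (leq_trans K0 Kk) ks.
have sr0 : 0 < s%:R :> R by rewrite ltr0n.
have slr0 : 0 < (s + l)%:R :> R by rewrite ltr0n addn_gt0 s0.
have Klr0 : 0 < (K + l)%:R :> R by rewrite ltr0n addn_gt0 K0.
have e0 : 0 <= bin_ratio (N m) m s :> R by exact: bin_ratio_ge0.
have ratio_shift : p ^+ l * bin_ratio (N m) m s <= bin_ratio (N m) m (s + l).
  have sMl : (s + l <= M + l)%N by rewrite leq_add2r ltnW.
  apply: bin_ratio_shift_ge (ltW p0) (leq_trans sMl Mlm) _.
  by apply: le_trans pMN; rewrite lerD2l ler_nat.
apply: le_trans (_ : _ <= B * (p ^+ l * bin_ratio (N m) m s / (s + l)%:R)) _;
  last first.
  by rewrite ler_wpM2l ?(ltW B0) // ler_wpM2r ?invr_ge0 ?(ltW slr0).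
have -> : B * (p ^+ l * bin_ratio (N m) m s / (s + l)%:R)
  = bin_ratio (N m) m s / s%:R * (p ^+ l * (s%:R / (s + l)%:R) * B).
  by field; rewrite -natrD !gt_eqF.
(* As s / (s + l) increases with [s], the hypothesis at [K] covers every s >= k >= K. *)
rewrite ler_peMr ?divr_ge0 //; apply: le_trans pKB _.
rewrite ler_wpM2r ?(ltW B0) // ler_wpM2l ?exprn_ge0 ?(ltW p0) //.
rewrite ler_pdivrMr // mulrAC ler_pdivlMr //.
by rewrite -!natrM ler_nat; clear -Kk ks; nia.
Unshelve. all: by end_near. Qed.

End LargeRank.

(** * Application to the selection probabilities *)

Section Secretary.
Context {R : realType}.

Let q : R := 1 - (expR 1)^-1.

(** The number of candidates passed over unconditionally, t_n - 1, indexed by m = n - 1. *)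
Definition rejected (m : nat) : nat := (threshold R m.+1).-1.

Definition remaining (m : nat) : nat := (m.+1 - rejected m)%N.

Lemma onem_invn_expR1 : 0 < q < 1.
Proof.
have e1 : 1 < expR 1 :> R by rewrite expR_gt1.
have e0 : 0 < expR 1 :> R by exact: expR_gt0.
by rewrite /q subr_gt0 invf_lt1 // e1 /= ltrBlDr ltrDl invr_gt0.
Qed.

Lemma remaining_bounds (m : nat) :
  q * m%:R - 1 <= (remaining m)%:R <= q * m%:R + 2.
Proof.
have := onem_invn_expR1; have := @threshold_ge R m.+1.
have := @threshold_le R m.+1; have := @threshold_gt0 R m.+1.
rewrite /remaining /rejected.
set t := threshold R m.+1 => t0.
have m0 : 0 <= m%:R :> R by [].
have -> : (m.+1 - t.-1 = m.+2 - t)%N by lia.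
have -> : m.+1%:R = m%:R + 1 :> R by rewrite natr1.
have -> : (expR 1)^-1 = 1 - q by rewrite /q; ring.
move=> t_le t_ge /andP[q0 q1].
have qm : 0 <= q * m%:R by rewrite mulr_ge0 // ltW.
have [tm|mt] := leqP t m.+2.
  rewrite natrB // -[m.+2]addn2 natrD; apply/andP; split.
    by move: t_le; nra.
  by move: t_ge; nra.
have mt' : m%:R + 2 <= t%:R :> R by rewrite -natrD addn2 ler_nat ltnW.
have -> : (m.+2 - t = 0)%N by lia.
by apply/andP; split; [move: t_le; nra|lra].
Qed.

Lemma cvg_remaining : (remaining m)%:R / m%:R @[m --> \oo] --> q.
Proof.
have lo : q - 1 / m%:R @[m --> \oo] --> q - 0.
  by apply: cvgB; [exact: cvg_cst|exact: cvg_divn].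
have hi : q + 2 / m%:R @[m --> \oo] --> q + 0.
  by apply: cvgD; [exact: cvg_cst|exact: cvg_divn].
rewrite subr0 in lo; rewrite addr0 in hi.
apply: squeeze_cvgr lo hi; near=> m.
have m0 : 0 < m%:R :> R by rewrite ltr0n; near: m; exact: nbhs_infty_gt.
have /andP[h1 h2] := remaining_bounds m.
have mn0 : m%:R != 0 :> R by rewrite gt_eqF.
rewrite ler_pdivlMr // ler_pdivrMr // [(q - _) * _]mulrBl [(q + _) * _]mulrDl.
rewrite !divfK //.
by rewrite h1 h2.
Unshelve. all: by end_near. Qed.

Lemma rejected_ge (m : nat) : m.+1%:R / expR 1 - 1 <= (rejected m)%:R :> R.
Proof.
rewrite lerBlDr natr1 /rejected prednK ?threshold_gt0 //.
exact: threshold_ge.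
Qed.

Lemma near_rejected_gt (j : nat) : \forall m \near \oo, (j < rejected m)%N.
Proof.
near=> m; rewrite -(ltr_nat R); apply: lt_le_trans (rejected_ge m).
rewrite ltrBrDr ltr_pdivlMr ?expR_gt0 //.
apply: lt_le_trans (_ : _ < m%:R) _; last by rewrite ler_nat.
have hb := @archi_boundP R ((j%:R + 1) * expR 1).
apply: lt_le_trans (hb _) _; first by rewrite mulr_ge0 ?addr_ge0 ?expR_ge0.
by rewrite ler_nat; near: m; exact: nbhs_infty_ge.
Unshelve. all: by end_near. Qed.

(** For k = 1 the binomial quotients are 1 and the tail is the harmonic sum from t_n - 1. It exceeds
    1 by minimality, and drops to at most 1 once its first term is removed. *)
Lemma near_bin_tail1 : \forall m \near \oo,
  1 <= (bin_tail (remaining m) m 1 : R) <= 1 + (rejected m)%:R^-1.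
Proof.
near=> m.
have t1 : (0 < rejected m)%N by near: m; exact: near_rejected_gt.
rewrite -sum_bin_ratio // subSS subn0.
have -> : \sum_(rejected m <= j < m.+1) ('C(m, j)%:R / 'C(m, j)%:R / j%:R)
    = \sum_(rejected m <= j < m.+1) j%:R^-1 :> R.
  apply: eq_big_nat => j /andP[_ jm].
  by rewrite divff ?mul1r // pnatr_eq0 -lt0n bin_gt0.
have t2 : (1 < threshold R m.+1)%N by move: t1; rewrite /rejected; lia.
rewrite ltW /=; last exact: sum_threshold_pred_gt1.
have [tm|mt] := leqP m.+1 (rejected m).
  by rewrite big_geq // addr_ge0.
rewrite big_ltn // addrC lerD2r /rejected prednK ?threshold_gt0 //.
exact: sum_threshold_le1.
Unshelve. all: by end_near. Qed.

Lemma cvg_bin_tail1 : bin_tail (remaining m) m 1 @[m --> \oo] --> (1 : R).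
Proof.
have h : 1 + (rejected m)%:R^-1 @[m --> \oo] --> (1 + 0 : R).
  apply: cvgD; first exact: cvg_cst.
  apply: (cvg_comp rejected (fun j : nat => j%:R^-1 : R)); last exact: cvg_invn.
  apply/cvgnyPgt => j; exact: near_rejected_gt.
rewrite addr0 in h; apply: squeeze_cvgr (cvg_cst (1 : R)) h.
exact: near_bin_tail1.
Qed.

Local Notation b := (log_rest q).

Let q01 := onem_invn_expR1.

Lemma cvg_remaining_tail (k : nat) : (0 < k)%N ->
  bin_tail (remaining m) m k @[m --> \oo] --> b k.
Proof. exact: (cvg_bin_tail _ _ q01 cvg_remaining cvg_bin_tail1). Qed.

Lemma log_tailE (m : nat) : (0 < m)%N -> log_tail R m = b m.
Proof. exact: (log_rest_series _ _ q01 cvg_remaining cvg_bin_tail1). Qed.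

Lemma cvg_b : b k @[k --> \oo] --> 0.
Proof. exact: (cvg_log_rest _ _ q01 cvg_remaining cvg_bin_tail1). Qed.

Lemma log_rest_pos (k : nat) : (0 < k)%N -> 0 < b k.
Proof. exact: (log_rest_gt0 _ _ q01 cvg_remaining cvg_bin_tail1). Qed.

Lemma select_probE (m k : nat) : (0 < rejected m)%N -> (0 < k <= m.+1)%N ->
  select_prob R k m.+1 = (rejected m)%:R / m.+1%:R *
    (bin_tail (remaining m) m k + m%:R^-1).
Proof.
move=> t0 /andP[k0 km]; rewrite /select_prob.
have tE : threshold R m.+1 = (rejected m).+1.
  by rewrite /rejected prednK ?threshold_gt0.
rewrite tE -[in X in X - 1]natr1 addrK -natr1 addrK; congr (_ * (_ + _)).
rewrite -sum_bin_ratio ?k0 // big_add1 /= subn1 /=.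
rewrite addn1.
have [tk|kt] := leqP (rejected m) (m.+1 - k).+1; last first.
  rewrite big_geq; last by lia.
  rewrite big_nat big1 // => j /andP[tj _].
  by rewrite bin_small ?mul0r //; lia.
(* The tail form runs up to [m]; its terms with j > m + 1 - k vanish with their numerator. *)
rewrite [RHS](@big_cat_nat _ _ _ (m.+1 - k).+1) //=; last by lia.
rewrite [X in _ = _ + X]big_nat [X in _ = _ + X]big1 ?addr0.
  by apply: eq_big_nat => j _; rewrite subn1 /= -natr1 addrK.
by move=> j /andP[kj _]; rewrite bin_small ?mul0r //; lia.
Qed.

Lemma select_prob_ratioE (m k l : nat) : (0 < rejected m)%N ->
  (0 < k)%N -> (k + l <= m.+1)%N ->
  select_prob R k m.+1 / select_prob R (k + l) m.+1 =
  (bin_tail (remaining m) m k + m%:R^-1) /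
  (bin_tail (remaining m) m (k + l) + m%:R^-1).
Proof.
move=> t0 k0 klm; rewrite !select_probE //; [|lia|lia].
by rewrite -mulf_div divff ?mul1r // mulf_neq0 ?invr_eq0 ?pnatr_eq0; lia.
Qed.

Lemma cvg_select_prob_ratio (k l : nat) : (0 < k)%N ->
  select_prob R k n / select_prob R (k + l) n @[n --> \oo]
    --> b k / b (k + l)%N.
Proof.
move=> k0; rewrite -cvg_shiftS /=.
have h j : (0 < j)%N ->
    bin_tail (remaining m) m j + m%:R^-1 @[m --> \oo] --> b j + 0.
  by move=> j0; apply: cvgD; [exact: cvg_remaining_tail|exact: cvg_invn].
have kl0 : (0 < k + l)%N by lia.
have bkl : b (k + l)%N + 0 != 0.
  by rewrite addr0 gt_eqF ?log_rest_pos.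
have hr : (bin_tail (remaining m) m k + m%:R^-1) /
    (bin_tail (remaining m) m (k + l) + m%:R^-1) @[m --> \oo]
    --> (b k + 0) / (b (k + l)%N + 0).
  by apply: cvgM; [exact: h|apply: cvgV; [|exact: h]].
rewrite !addr0 in hr; apply: cvg_trans hr; apply: near_eq_cvg.
near=> m; rewrite select_prob_ratioE //; near: m.
  exact: near_rejected_gt.
by apply: filterS (nbhs_infty_ge (k + l)) => m /=; exact: leqW.
Unshelve. all: by end_near. Qed.

(** * A bound strictly below 1 / a_{l+1}, uniform in the rank *)

Section UniformBound.
Variable l : nat.
Hypothesis l_gt0 : (0 < l)%N.

Let bS := log_restS q.

Lemma exists_bound : exists B : R,
  [/\ B < 1 / b l.+1, 1 < q ^+ l * B &
      forall k, (2 <= k)%N -> b k / b (k + l)%N < B].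
Proof.
have /andP[q0 q1] := q01.
(* Because a_1 = 1, the ratio at rank 1 is exactly 1 / a_{l+1}, so strict monotonicity from rank 1
   to rank 2 leaves room for [B]. *)
have b1 : b 1 = 1 by rewrite /log_rest big_geq ?subr0.
have lt12 : b 2 / b (2 + l)%N < 1 / b l.+1.
  have := rest_ratio_lt q b l q01 bS cvg_b l_gt0 1 isT.
  rewrite b1 divr1 add1n => h; rewrite -[X in X < _]invf_div div1r.
  by rewrite ltf_pV2 ?posrE ?divr_gt0 ?log_rest_pos.
pose B := (b 2 / b (2 + l)%N + 1 / b l.+1) / 2; exists B.
have b2B : b 2 / b (2 + l)%N < B by rewrite /B; lra.
split; first by rewrite /B; lra.
- have := rest_ratio_le q b l q01 bS cvg_b l_gt0 2 isT.
  move=> h; apply: le_lt_trans (_ : q ^+ l * (b 2 / b (2 + l)%N) < _); last first.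
    by rewrite ltr_pM2l ?exprn_gt0.
  by rewrite mulrA ler_pdivlMr ?mul1r ?log_rest_pos.
- move=> k k2; apply: le_lt_trans b2B.
  rewrite -[leLHS]invf_div -[leRHS]invf_div.
  rewrite lef_pV2 ?posrE ?divr_gt0 ?log_rest_pos //; try lia.
  by apply: (rest_ratio_mono q b l q01 bS cvg_b l_gt0); lia.
Qed.

(** A single parameter [j] supplies both witnesses, p = q - q/j and K = j: the expression tends to
    q^l B > 1. *)
Lemma exists_rate_rank (B : R) : 1 < q ^+ l * B ->
  exists p K, [/\ 0 < p < q, (0 < K)%N &
    1 <= p ^+ l * (K%:R / (K + l)%:R) * B].
Proof.
move=> qB; have /andP[q0 q1] := q01.
pose f (j : nat) : R := (q - q / j%:R) ^+ l * (1 + l%:R / j%:R)^-1 * B.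
have h : f j @[j --> \oo] --> (q - 0) ^+ l * (1 + 0)^-1 * B.
  apply: cvgMr_tmp; apply: cvgM.
    apply: (cvg_comp (fun j : nat => q - q / j%:R) (fun x : R => x ^+ l)).
      by apply: cvgB; [exact: cvg_cst|exact: cvg_divn].
    exact: exprn_continuous.
  apply: cvgV; first by rewrite addr0 oner_eq0.
  by apply: cvgD; [exact: cvg_cst|exact: cvg_divn].
rewrite subr0 addr0 invr1 mulr1 in h.
have [j [j1 fj]] : exists j : nat, (1 < j)%N /\ 1 < f j.
  have [j _ H] := filterI (nbhs_infty_gt 1) (cvgr_gt _ h _ qB).
  by exists j; apply: (H j) => /=.
have jr1 : 1 < j%:R :> R by rewrite ltr1n.
have jr0 : 0 < j%:R :> R by lra.
exists (q - q / j%:R), j; split; last 1 first.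
- have -> : j%:R / (j + l)%:R = (1 + l%:R / j%:R)^-1 :> R.
    rewrite natrD; field.
    by rewrite gt_eqF //= gt_eqF // ltr_pwDl.
  exact: ltW.
- by rewrite subr_gt0 ltr_pdivrMr // ltr_pMr // jr1 /= ltrBlDr ltrDl divr_gt0.
- by lia.
Qed.

Lemma near_tail_le (B : R) : 1 < q ^+ l * B ->
  (forall k, (2 <= k)%N -> b k / b (k + l)%N < B) ->
  \forall m \near \oo, forall k, (2 <= k)%N ->
    bin_tail (remaining m) m k
      <= B * bin_tail (remaining m) m (k + l) + (B - 1) / m%:R.
Proof.
move=> qB bB; have /andP[q0 q1] := q01.
have ql0 : 0 < q ^+ l by rewrite exprn_gt0.
have B0 : 0 < B by rewrite -(pmulr_rgt0 _ ql0); lra.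
have B1 : 1 < B.
  apply: lt_le_trans qB _; rewrite ler_piMl ?(ltW B0) //.
  by rewrite exprn_ile1 ?ltW.
have [p [K [pq K0 pKB]]] := exists_rate_rank B qB.
have large := near_tail_le_large q remaining q01 cvg_remaining p B K l pq B1 K0 pKB.
(* Below a fixed rank only finitely many eventual inequalities are intersected, each coming from the
   strict limit b k < B * b (k + l). *)
have small K' : \forall m \near \oo, forall k, (2 <= k < K')%N ->
    bin_tail (remaining m) m k
      <= B * bin_tail (remaining m) m (k + l) + (B - 1) / m%:R.
  elim: K' => [|K' IH]; first by apply: nearW => m k; rewrite andbF.
  have [K2|K2] := leqP 2 K'; last first.
    by apply: nearW => m k /andP[k2] /(leq_trans k2); rewrite ltnNge -ltnS K2.
  have hK : \forall m \near \oo,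
      0 < B * bin_tail (remaining m) m (K' + l) - bin_tail (remaining m) m K'.
    have h : B * bin_tail (remaining m) m (K' + l) - bin_tail (remaining m) m K'
        @[m --> \oo] --> B * b (K' + l)%N - b K'.
      apply: cvgB; last by apply: cvg_remaining_tail; lia.
      by apply: cvgMl_tmp; apply: cvg_remaining_tail; lia.
    apply: (cvgr_gt _ h); rewrite subr_gt0 -ltr_pdivrMr ?bB //.
    by apply: log_rest_pos; lia.
  apply: filterS2 IH hK => m IHm hm k /andP[k2]; rewrite ltnS leq_eqVlt.
  case/orP => [/eqP ->|kK']; last by apply: IHm; rewrite k2.
  apply: (@le_trans _ _ (B * bin_tail (remaining m) m (K' + l))).
    by rewrite -subr_ge0 ltW.
  by rewrite lerDl divr_ge0 // subr_ge0 ltW.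
apply: filterS2 (small K) large => m sm lg k k2.
by have [Kk|kK] := leqP K k; [exact: lg|apply: sm; rewrite k2].
Qed.

Lemma near_select_prob_ratio_le : exists2 B : R, B < 1 / b l.+1 &
  \forall n \near \oo, forall k, (2 <= k)%N -> (k + l <= n)%N ->
    select_prob R k n / select_prob R (k + l) n <= B.
Proof.
have [B [Bb qB bB]] := exists_bound; exists B => //.
apply: near_inftyS; near=> m.
have m0 : 0 < m%:R^-1 :> R.
  by rewrite invr_gt0 ltr0n; near: m; exact: nbhs_infty_gt.
have t0 : (0 < rejected m)%N by near: m; exact: near_rejected_gt.
have h : forall k, (2 <= k)%N -> bin_tail (remaining m) m k
    <= B * bin_tail (remaining m) m (k + l) + (B - 1) / m%:R.
  by near: m; exact: near_tail_le.
move=> k k2 klm; rewrite select_prob_ratioE ?(ltnW k2) //.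
rewrite ler_pdivrMr; last by rewrite ltr_wpDl ?bin_tail_ge0.
(* Splitting (B - 1) / m as B/m - 1/m adds the common summand 1/m to both tails. *)
by move: (h k k2); rewrite mulrBl mul1r mulrDr addrA -lerBrDr.
Unshelve. all: by end_near. Qed.

End UniformBound.
End Secretary.

(** A fixed rank yields a genuine limit. For a rank varying with [n] convergence is not claimed, and
    the limit superior is bounded instead, which controls the limit whenever it exists. *)
Theorem theorem7 (R : realType) (l : nat) (hl : (1 <= l)%N) :
  (forall k : nat, (2 <= k)%N ->
     let u : nat -> R :=
       fun n => select_prob R k n / select_prob R (k + l) n in
     exists L : R, u @ \oo --> L /\ L < 1 / log_tail R l.+1) /\
  (forall k : nat -> nat,
     (forall n : nat, (l.+2 <= n)%N -> (2 <= k n <= n - l)%N) ->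
     let u : nat -> R :=
       fun n => select_prob R (k n) n / select_prob R (k n + l) n in
     (limn_esup (fun n => (u n)%:E) < (1 / log_tail R l.+1)%:E)%E).
Proof.
rewrite log_tailE //.
have [B Bb ratio_le] := @near_select_prob_ratio_le R l hl.
split=> k hk; cbv zeta.
- have ucvg := @cvg_select_prob_ratio R k l (ltnW hk).
  exists (log_rest (1 - (expR 1)^-1) k / log_rest (1 - (expR 1)^-1) (k + l)).
  split; first exact: ucvg.
  apply: le_lt_trans Bb; apply: (cvgr_to_le ucvg).
  apply: filterS2 ratio_le (nbhs_infty_ge (k + l)) => n ratio_le_n kln.
  exact: ratio_le_n.
- pose u n := select_prob R (k n) n / select_prob R (k n + l) n.
  have uB : \forall n \near \oo, u n <= B.
    apply: filterS2 ratio_le (nbhs_infty_ge l.+2) => n ratio_le_n ln.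
    have /andP[k2 kn] := hk n ln; apply: ratio_le_n => //.
    by rewrite addnC -leq_subRL //; exact: leq_trans (leqW (leqnSn l)) ln.
  apply: (@le_lt_trans _ _ B%:E); last by rewrite lte_fin.
  rewrite /limn_esup limf_esupE; apply: ereal_inf_le.
  (* The set where u n <= B is itself a neighbourhood of infinity, and its supremum bounds the limit
     superior. *)
  exists (ereal_sup ((fun n => (u n)%:E) @` [set n | u n <= B])).
    by exists [set n | u n <= B].
  by apply: ge_ereal_sup => _ [n /= un <-]; rewrite lee_fin.
Qed.
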